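(* Let $A,S\in\mathbb{R}^{n\times n}$ with $S$ symmetric positive semidefinite, let $Z\in\mathbb{R}^{n\times p}$, $C\in\mathbb{R}^{n\times q}$, and consider the differential Riccati equation $\dot X=AX+XA^T+CC^T-XSX$, $X(0)=ZZ^T$. Let $V_k$ be a matrix with orthonormal columns spanning the block Krylov subspace $\mathcal{K}_k(A,[Z\ \ C])$, and put $H_k=V_k^TAV_k$, $S_k=V_k^TSV_k$, $C_k=V_k^TC$, $Z_k=V_k^TZ$. Then the Krylov approximation preserves positivity, in the following sense. (a) The solution $Y_k(t)$ of the projected equation $\dot Y_k=H_kY_k+Y_kH_k^T+C_kC_k^T-Y_kS_kY_k$, $Y_k(0)=Z_kZ_k^T$, exists for all $t>0$, and $X_k(t)=V_kY_k(t)V_k^T$ is symmetric positive semidefinite. (b) The same holds if the projected equation is solved by the modified Davison--Maki method with the diagonal Padé approximant of order 13 described in the context: for every $t>0$, every number of substeps $m\ge 1$ and every admissible scaling parameter $s$, all matrix inverses occurring in the method exist, each $Y_k^j$ ($0\le j\le m$) is symmetric positive semidefinite, and hence the resulting approximation $V_kY_k^mV_k^T$ of $X(t)$ is symmetric positive semidefinite.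
   Context: Block Krylov subspace: for $A\in\mathbb{R}^{n\times n}$ and $B\in\mathbb{R}^{n\times\ell}$, $\mathcal{K}_k(A,B)$ is the span of the columns of $B,AB,\dots,A^{k-1}B$. Modified Davison--Maki method for a small symmetric Riccati equation $\dot Y=HY+YH^T+\hat Q-Y\hat SY$, $Y(0)=Y^0$: let $$\mathcal{H}=\begin{bmatrix}-H^T&\hat S\\ \hat Q&H\end{bmatrix},\qquad \Delta t=t/m,$$ and for $j=0,\dots,m-1$ set $$\begin{bmatrix}U_{j+1}\\ W_{j+1}\end{bmatrix}=E\begin{bmatrix}I\\ Y^j\end{bmatrix},\qquad Y^{j+1}=W_{j+1}U_{j+1}^{-1},$$ where $E\approx\exp(\Delta t\,\mathcal{H})$. Here $H=H_k$, $\hat S=S_k$, $\hat Q=C_kC_k^T$, $Y^0=Z_kZ_k^T$, and the iterates are denoted $Y_k^j$. The matrix $E$ is computed by the 13th order diagonal Padé approximant with scaling and squaring: $$E=\big(r(2^{-s}\Delta t\,\mathcal{H})\big)^{2^s},\quad r(x)=\frac{p(x)}{p(-x)},\quad p(x)=\sum_{j=0}^{13}\frac{(26-j)!\,13!}{26!\,j!\,(13-j)!}x^j,$$ where the integer $s\ge 0$ is called admissible if $2^{-s}\|\Delta t\,\mathcal{H}\|_1\le\theta_{13}=5.371920351148152$ ($\|\cdot\|_1$ the maximum column sum norm). *)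

(* Defs.v *)
From HB Require Import structures.
From mathcomp Require Import all_boot all_order all_algebra.
From mathcomp Require Import all_classical all_reals all_analysis.

Set Implicit Arguments.
Unset Strict Implicit.
Unset Printing Implicit Defensive.

Import Order.TTheory GRing.Theory Num.Theory numFieldNormedType.Exports.

Local Open Scope classical_set_scope.
Local Open Scope ring_scope.

Definition psdmx (R : realType) (n : nat) (M : 'M[R]_n) : Prop :=
  M^T = M /\ forall x : 'cV[R]_n, 0 <= (x^T *m M *m x) 0 0.

Definition colspan (R : realType) (n l : nat) (M : 'M[R]_(n, l)) :
    {vspace 'cV[R]_n} :=
  <<[seq col j M | j <- enum 'I_l]>>%VS.

Definition krylov (R : realType) (n l k : nat)
    (A : 'M[R]_n) (B : 'M[R]_(n, l)) : {vspace 'cV[R]_n} :=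
  <<[seq col j (A ^+ i *m B) | i <- iota 0 k, j <- enum 'I_l]>>%VS.

Definition riccati_rhs (R : realType) (r : nat) (H S Q Y : 'M[R]_r) : 'M[R]_r :=
  H *m Y + Y *m H^T + Q - Y *m S *m Y.

(* Classical solution on [0, T[, where T may be +oo. Values of Y outside
   [0, T[ are irrelevant; with right-continuity at 0, the equation on ]0, T[
   also forces the right derivative at 0 to be the right-hand side at Y0. *)
Definition riccati_solution (R : realType) (r : nat) (H S Q Y0 : 'M[R]_r)
    (T : \bar R) (Y : R -> 'M[R]_r) : Prop :=
  [/\ Y 0 = Y0,
      Y u @[u --> 0^'+] --> Y0 &
      forall u : R, 0 < u -> (u%:E < T)%E ->
        is_derive u 1 Y (riccati_rhs H S Q (Y u))].

Definition mxnorm1 (R : realType) (m n : nat) (M : 'M[R]_(m, n)) : R :=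
  \big[Num.max/0]_(j < n) \sum_(i < m) `|M i j|.

Definition pade13_coef (R : realType) (j : nat) : R :=
  (26 - j)`!%:R * 13`!%:R / (26`!%:R * j`!%:R * (13 - j)`!%:R).

(* The sum is written out because horner_mx is restricted to matrices of
   positive size, and the projected problem may have size 0. *)
Definition pade13_poly (R : realType) (n : nat) (M : 'M[R]_n) : 'M[R]_n :=
  \sum_(j < 14) pade13_coef R j *: M ^+ j.

Definition pade13 (R : realType) (n : nat) (M : 'M[R]_n) : 'M[R]_n :=
  pade13_poly M *m invmx (pade13_poly (- M)).

Definition pade13_exp (R : realType) (n s : nat) (M : 'M[R]_n) : 'M[R]_n :=
  pade13 (2 ^- s *: M) ^+ (2 ^ s)%N.

(* 5.371920351148152; split because a 16-digit numeral is a unary nat in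
   ring_scope. *)
Definition theta13 (R : realType) : R :=
  5 + 371 / 10 ^+ 3 + 920 / 10 ^+ 6 + 351 / 10 ^+ 9
    + 148 / 10 ^+ 12 + 152 / 10 ^+ 15.

Definition admissible (R : realType) (n s : nat) (M : 'M[R]_n) : Prop :=
  2 ^- s * mxnorm1 M <= theta13 R.

Definition hamiltonian (R : realType) (r : nat) (H S Q : 'M[R]_r) :
    'M[R]_(r + r) :=
  block_mx (- H^T) S Q H.

Definition dm_U (R : realType) (r : nat) (E : 'M[R]_(r + r)) (Y : 'M[R]_r) :
    'M[R]_r :=
  usubmx (E *m col_mx 1%:M Y).

Definition dm_W (R : realType) (r : nat) (E : 'M[R]_(r + r)) (Y : 'M[R]_r) :
    'M[R]_r :=
  dsubmx (E *m col_mx 1%:M Y).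

Definition dm_iter (R : realType) (r : nat) (E : 'M[R]_(r + r))
    (Y0 : 'M[R]_r) (j : nat) : 'M[R]_r :=
  iter j (fun Y => dm_W E Y *m invmx (dm_U E Y)) Y0.

(* Main.v *)
From Stdlib Require Import BinInt.
Require Import Defs.
From HB Require Import structures.
From mathcomp Require Import all_boot all_order all_algebra.
From mathcomp Require Import all_classical all_reals all_analysis.
From mathcomp Require Import perm ssrZ zify ring lra.

(** Write [M] for the Hamiltonian matrix with blocks [- H^T], [S], [Q], [H], and
    split vectors as [x = (u, w)]. Along [M] the quadratic form [u^T w] does not
    decrease: the terms with [H] cancel and its growth rate is
    [u^T Q u + w^T S w >= 0]. Moreover [M] is skew for the symplectic form.

    Let [E] preserve the symplectic form and not decrease [u^T w], and let
    [(U, W)] be the image under [E] of [(1, Y)] with [Y] symmetric positive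
    semidefinite. Then [U^T W] is symmetric and dominates [Y], so that
    [W U^-1 = U^-T (U^T W) U^-1] is positive semidefinite as soon as [U] is
    invertible. If [U a = 0], then [u^T w] is zero at [E (a, Y a)] and nonnegative
    at [(a, Y a)], so the positive semidefinite form that measures the growth
    vanishes at [(a, Y a)]; a vector where such a form vanishes lies in its kernel,
    and combining this with the symplectic form gives [a = 0]
    ([riccati_flow_usub], [riccati_flow_step]). It remains to see that both
    propagators have the two properties, which [riccati_flow] collects.

    For part (a), [E] is [mxexp M t] ([mxexp_flow]), and [W U^-1] solves the Riccati
    equation ([is_derive_riccati_Y]). Any other solution [Y'] agrees with it as long
    as it lives, because [Y' U - W] solves a homogeneous linear equation with
    zero initial value ([riccati_unique]).

    For part (b), [E] is a power of the Padé approximant [p(x) / p(- x)] at a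
    multiple of [M] ([pade13_flow]). The quotient of the odd and even parts of [p]
    is the convergent [1 / (2/x + 1 / (6/x + ... + 1 / (50/x)))] of [tanh (x / 2)].
    Unrolling this continued fraction writes the growth of the form under one
    step as a sum of its growth rates along [M] at several vectors, weighted by the
    positive partial denominators ([bform_cf_cons]). This plays the role of
    A-stability for the indefinite form at hand, and involves no roots of [p].
    The matrix [p(- T)] is invertible if the 1-norm of [T] is at most [6], a little
    more than [theta13], because the product of [p(- x)] with a Taylor polynomial
    of [exp (x / 2)] is dominated by its constant term ([pade13_den_unit]). *)

Set Implicit Arguments.
Unset Strict Implicit.
Unset Printing Implicit Defensive.

Import Order.TTheory GRing.Theory Num.Theory numFieldNormedType.Exports.

Local Open Scope classical_set_scope.
Local Open Scope ring_scope.

(** * Polynomials with binary integer coefficients, evaluated at matrices *)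
Section IntegerPolynomials.

(** The identities below involve coefficients of the size of [26`!]. Over the
    binary integers they are decided by computation. The constant coefficient
    comes first. *)
Fixpoint lpadd (c d : seq Z) : seq Z :=
  match c, d with
  | [::], _ => d
  | _, [::] => c
  | a :: c', b :: d' => (a + b) :: lpadd c' d'
  end.

Definition lpscale (a : Z) (c : seq Z) : seq Z := [seq a * b | b <- c].

Fixpoint lpmul (c d : seq Z) : seq Z :=
  if c is a :: c' then lpadd (lpscale a d) (0 :: lpmul c' d) else [::].

Variable R : realType.

Definition zr (a : Z) : R := (int_of_Z a)%:~R.

Lemma zr0 : zr 0 = 0. Proof. by rewrite /zr rmorph0. Qed.
Lemma zr1 : zr 1 = 1. Proof. by rewrite /zr rmorph1. Qed.
Lemma zrD a b : zr (a + b) = zr a + zr b.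
Proof. by rewrite /zr rmorphD rmorphD. Qed.
Lemma zrM a b : zr (a * b) = zr a * zr b.
Proof. by rewrite /zr rmorphM rmorphM. Qed.
Lemma zr_nat n : zr (Z.of_nat n) = n%:R.
Proof. by rewrite /zr -[Z.of_nat n]/(Z_of_int n%:Z) Z_of_intK. Qed.

Lemma zr_gt0 (b : Z) : 0 < b -> 0 < zr b.
Proof. by move=> b0; rewrite /zr ltr0z; case: b b0 => [|p|p] //=; lia. Qed.

Definition lpeval n (c : seq Z) (T : 'M[R]_n) : 'M[R]_n :=
  foldr (fun a X => (zr a)%:M + T *m X) 0 c.

Lemma lpeval_add n c d (T : 'M[R]_n) :
  lpeval (lpadd c d) T = lpeval c T + lpeval d T.
Proof.
elim: c d => [|a c IH] [|b d] /=; rewrite ?add0r ?addr0 //.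
by rewrite IH zrD raddfD mulmxDr /=; rewrite addrACA.
Qed.

Lemma lpeval_scale n a c (T : 'M[R]_n) :
  lpeval (lpscale a c) T = zr a *: lpeval c T.
Proof.
elim: c => [|b c IH] /=; first by rewrite scaler0.
by rewrite IH zrM scalerDr scale_scalar_mx -scalemxAr.
Qed.

Lemma lpeval_shift n c (T : 'M[R]_n) : lpeval (0 :: c) T = T *m lpeval c T.
Proof. by rewrite /= zr0 raddf0 add0r. Qed.

Lemma lpeval_mul n c d (T : 'M[R]_n) :
  lpeval (lpmul c d) T = lpeval c T *m lpeval d T.
Proof.
elim: c => [|a c IH] /=; first by rewrite mul0mx.
by rewrite lpeval_add lpeval_shift lpeval_scale IH mulmxDl mul_scalar_mx mulmxA.
Qed.

Lemma lpeval_comm n c (T X : 'M[R]_n) :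
  T *m X = X *m T -> lpeval c T *m X = X *m lpeval c T.
Proof.
move=> TX; elim: c => [|a c IH] /=; first by rewrite mul0mx mulmx0.
by rewrite mulmxDl mulmxDr scalar_mxC -!mulmxA IH !mulmxA TX.
Qed.

Lemma lpevalE n c (T : 'M[R]_n) :
  lpeval c T = \sum_(j < size c) zr (nth 0 c j) *: T ^+ j.
Proof.
elim: c => [|a c IH] /=; first by rewrite big_ord0.
rewrite big_ord_recl /= expr0 scalemx1 IH mulmx_sumr; congr (_ + _).
by apply: eq_bigr => j _; rewrite -scalemxAr exprS.
Qed.

End IntegerPolynomials.

(** * Truncated continued fractions of tanh type *)
Section ContinuedFraction.

(** Numerator and denominator of the finite continued fraction
    [1 / (b1 / x + 1 / (b2 / x + ...))]. The partial denominators [2, 6, 10, ...]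
    give the convergents of [tanh (x / 2)]. *)
Fixpoint cf_pair (bs : seq Z) : seq Z * seq Z :=
  if bs is b :: bs' then
    let: (u, d) := cf_pair bs' in
    (0 :: d, lpadd (lpscale b d) (0 :: u))
  else ([::], [:: 1]).

Definition cf_num bs := (cf_pair bs).1.
Definition cf_den bs := (cf_pair bs).2.

Lemma cf_numE b bs : cf_num (b :: bs) = 0 :: cf_den bs.
Proof. by rewrite /cf_num /cf_den /=; case: cf_pair. Qed.

Lemma cf_denE b bs :
  cf_den (b :: bs) = lpadd (lpscale b (cf_den bs)) (0 :: cf_num bs).
Proof. by rewrite /cf_num /cf_den /=; case: cf_pair. Qed.

Variables (R : realType) (n : nat).
Implicit Types T : 'M[R]_n.

Lemma lpeval_cf_num b bs T :
  lpeval (cf_num (b :: bs)) T = T *m lpeval (cf_den bs) T.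
Proof. by rewrite cf_numE lpeval_shift. Qed.

Lemma lpeval_cf_den b bs T :
  lpeval (cf_den (b :: bs)) T =
  zr R b *: lpeval (cf_den bs) T + T *m lpeval (cf_num bs) T.
Proof. by rewrite cf_denE lpeval_add lpeval_shift lpeval_scale. Qed.

(** The numerator is an odd polynomial and the denominator an even one. *)
Lemma lpeval_cf_opp bs T :
  (lpeval (cf_num bs) (- T) = - lpeval (cf_num bs) T) *
  (lpeval (cf_den bs) (- T) = lpeval (cf_den bs) T).
Proof.
elim: bs => [|b bs [IHu IHd]]; first by rewrite /= oppr0 !mulmx0.
by rewrite !lpeval_cf_num !lpeval_cf_den IHu IHd mulNmx mulmxN mulNmx opprK.
Qed.

End ContinuedFraction.

(** * Bilinear forms and continued fractions of accretive matrices *)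
Section BilinearForms.
Variables (R : realType) (n : nat).
Implicit Types (K M : 'M[R]_n) (x y : 'cV[R]_n).

Definition bform K x y : R := (x^T *m K *m y) 0 0.

Lemma bformDl K x x' y : bform K (x + x') y = bform K x y + bform K x' y.
Proof. by rewrite /bform raddfD !mulmxDl mxE. Qed.
Lemma bformDr K x y y' : bform K x (y + y') = bform K x y + bform K x y'.
Proof. by rewrite /bform mulmxDr mxE. Qed.
Lemma bformNl K x y : bform K (- x) y = - bform K x y.
Proof. by rewrite /bform raddfN !mulNmx mxE. Qed.
Lemma bformNr K x y : bform K x (- y) = - bform K x y.
Proof. by rewrite /bform mulmxN mxE. Qed.
Lemma bformZl K a x y : bform K (a *: x) y = a * bform K x y.
Proof. by rewrite /bform linearZ /= -!scalemxAl mxE. Qed.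
Lemma bformZr K a x y : bform K x (a *: y) = a * bform K x y.
Proof. by rewrite /bform -scalemxAr mxE. Qed.
Lemma bform0l K y : bform K 0 y = 0.
Proof. by rewrite /bform trmx0 !mul0mx mxE. Qed.
Lemma bform0r K x : bform K x 0 = 0.
Proof. by rewrite /bform mulmx0 mxE. Qed.
Lemma bform_tr K x y : bform K^T x y = bform K y x.
Proof.
by rewrite /bform -[y^T *m K *m x]trmxK [RHS]mxE !trmx_mul trmxK mulmxA.
Qed.
Lemma bformMr K M x y : bform (K *m M) x y = bform K x (M *m y).
Proof. by rewrite /bform !mulmxA. Qed.
Lemma bformMl K M x y : bform K (M *m x) y = bform (M^T *m K) x y.
Proof. by rewrite /bform trmx_mul !mulmxA. Qed.
Lemma bform_oppmx K x y : bform (- K) x y = - bform K x y.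
Proof. by rewrite /bform mulmxN mulNmx mxE. Qed.
Lemma bform_congr A K x y : bform (A^T *m K *m A) x y = bform K (A *m x) (A *m y).
Proof. by rewrite /bform trmx_mul !mulmxA. Qed.
Lemma bformBmx K K' x y : bform (K - K') x y = bform K x y - bform K' x y.
Proof. by rewrite /bform mulmxBr mulmxBl mxE [X in _ + X]mxE. Qed.

(** Growth of a symmetric form under the Cayley map [(y - x) |-> (y + x)]. *)
Lemma bform_addsub_sym K x y : K^T = K ->
  bform K (y + x) (y + x) = bform K (y - x) (y - x) + 4 * bform K x y.
Proof.
move=> K_sym; have xy : bform K y x = bform K x y by rewrite -bform_tr K_sym.
by rewrite !bformDl !bformDr !bformNl !bformNr xy; ring.
Qed.

(** The same map preserves a form for which the cross terms cancel. *)
Lemma bform_addsub_cross K x y x' y' : bform K y x' = - bform K x y' ->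
  bform K (y + x) (y' + x') = bform K (y - x) (y' - x').
Proof. by rewrite !bformDl !bformDr !bformNl !bformNr => ->; ring. Qed.

End BilinearForms.

Section Accretive.
Variables (R : realType) (n : nat) (K M : 'M[R]_n).
Hypothesis K_sym : K^T = K.
Hypothesis M_accretive : forall x, 0 <= bform K (M *m x) x.

Let bform_sym x y : bform K x y = bform K y x.
Proof. by rewrite -[in LHS]K_sym bform_tr. Qed.

(** One continued fraction step. It is the matrix version of the decomposition
    of the Bezoutian of the odd and even parts of a stable polynomial into
    squares. The new square, a growth rate along [M], is weighted by the partial denominator, and the
    remainder is the same expression for the tail, at [M *m x]. *)
Lemma bform_cf_cons b bs x :
  bform K (lpeval (cf_num (b :: bs)) M *m x) (lpeval (cf_den (b :: bs)) M *m x) =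
  zr R b * bform K (M *m (lpeval (cf_den bs) M *m x)) (lpeval (cf_den bs) M *m x)
  + bform K (lpeval (cf_num bs) M *m (M *m x)) (lpeval (cf_den bs) M *m (M *m x)).
Proof.
rewrite lpeval_cf_num lpeval_cf_den mulmxDl bformDr -scalemxAl bformZr -!mulmxA.
congr (_ + _); rewrite bform_sym; congr (bform K _ _).
  by rewrite !mulmxA (lpeval_comm _ (erefl (M *m M))).
by rewrite !mulmxA (lpeval_comm _ (erefl (M *m M))).
Qed.

Lemma bform_cf_ge0 bs x : all (fun b : Z => 0 < b) bs ->
  0 <= bform K (lpeval (cf_num bs) M *m x) (lpeval (cf_den bs) M *m x).
Proof.
elim: bs x => [|b bs IH] x /=; first by rewrite mul0mx bform0l.
move=> /andP[b0 bs0]; rewrite bform_cf_cons addr_ge0 ?IH //.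
by rewrite mulr_ge0 // ltW // zr_gt0.
Qed.

End Accretive.

(** * The Padé polynomial of order 13 and its denominator *)
Section Pade13.

Definition bs13 : seq Z := [seq Z.of_nat (4 * k + 2) | k <- iota 0 13].

Definition lp13 : seq Z := lpadd (cf_num bs13) (cf_den bs13).

Fixpoint zfact (n : nat) : Z := if n is m.+1 then Z.of_nat n * zfact m else 1.

(** [2 ^ 8 * 8!] times the Taylor polynomial of degree 8 of [exp (x / 2)]. *)
Definition lp_exp_half : seq Z :=
  [seq Z.div (2 ^+ 8 * zfact 8) (2 ^+ i * zfact i) | i <- iota 0 9].

(** A multiple of the Padé polynomial at [- x], hence close to a multiple of
    [exp (- x / 2)]. *)
Definition lp13_opp : seq Z :=
  lpadd (cf_den bs13) (lpscale (-1) (cf_num bs13)).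

Fixpoint lpnorm (q : Z) (c : seq Z) : Z :=
  if c is a :: c' then Z.abs a + q * lpnorm q c' else 0.

(** The product of the two approximations is close to a constant: on the disk of
    radius 6 the constant term outweighs the sum of all other terms. *)
Lemma lp_exp_half_certificate :
  exists a c, [/\ lpmul lp_exp_half lp13_opp = a :: c, 0 <= a &
    6 * lpnorm 6 c < a].
Proof.
pose e := lpmul lp_exp_half lp13_opp.
by exists (nth 0 e 0), (behead e); split; vm_compute.
Qed.

Variable R : realType.

Lemma zr_fact n : zr R (zfact n) = n`!%:R.
Proof.
elim: n => [|n IH]; first exact: zr1.
by rewrite -[zfact n.+1]/(Z.of_nat n.+1 * zfact n) zrM IH zr_nat -natrM.
Qed.

Lemma fact_neq0 k : k`!%:R != 0 :> R.
Proof. by rewrite pnatr_eq0 -lt0n fact_gt0. Qed.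

(** This identifies the thirteenth convergent of [tanh (x / 2)] with the odd and
    even parts of the Padé polynomial, up to the factor [26`! / 13`!]. *)
Lemma lp13_coef j : (j < 14)%N ->
  zr R (nth 0 lp13 j) * (j`!%:R * (13 - j)`!%:R) = (26 - j)`!%:R.
Proof.
move=> j14; rewrite -!zr_fact -!zrM; congr zr; apply/eqP.
have: all (fun j => nth 0 lp13 j * (zfact j * zfact (13 - j)) == zfact (26 - j))
  (iota 0 14) by vm_compute.
by move=> /allP; apply; rewrite mem_iota.
Qed.

(** The scalar [13`! / 26`!] cancels in the Padé quotient, so only its being nonzero
    is recorded. *)
Lemma pade13_polyE : exists2 c : R, c != 0 & forall n (T : 'M[R]_n),
  (pade13_poly T = c *: (lpeval (cf_den bs13) T + lpeval (cf_num bs13) T)) *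
  (pade13_poly (- T) = c *: (lpeval (cf_den bs13) T - lpeval (cf_num bs13) T)).
Proof.
exists (13`!%:R / 26`!%:R).
  exact: mulf_neq0 (fact_neq0 _) (invr_neq0 (fact_neq0 _)).
set c : R := _ / _.
suff polyE n (T : 'M[R]_n) :
    pade13_poly T = c *: (lpeval (cf_den bs13) T + lpeval (cf_num bs13) T).
  by split; rewrite polyE ?lpeval_cf_opp.
rewrite addrC -lpeval_add -/lp13 lpevalE scaler_sumr /pade13_poly.
have -> : size lp13 = 14%N by vm_compute.
apply: eq_bigr => j _; rewrite scalerA; congr (_ *: _).
have cancel (a b d e f g : R) : f * (d * e) = g -> a != 0 -> d != 0 -> e != 0 ->
    g * b / (a * d * e) = b / a * f.
  by move=> <- a0 d0 e0; field; rewrite a0 d0 e0.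
exact: cancel (lp13_coef (ltn_ord j)) (fact_neq0 _) (fact_neq0 _) (fact_neq0 _).
Qed.

Variable n : nat.
Implicit Types (T : 'M[R]_n) (v : 'cV[R]_n).

Definition vnorm1 v : R := \sum_i `|v i 0|.

Lemma vnorm1_ge0 v : 0 <= vnorm1 v.
Proof. by apply: sumr_ge0. Qed.

Lemma vnorm1D v w : vnorm1 (v + w) <= vnorm1 v + vnorm1 w.
Proof. by rewrite -big_split ler_sum // => i _; rewrite mxE ler_normD. Qed.

Lemma vnorm1Z a v : vnorm1 (a *: v) = `|a| * vnorm1 v.
Proof. by rewrite mulr_sumr; apply: eq_bigr => i _; rewrite mxE normrM. Qed.

Lemma vnorm1_eq0 v : vnorm1 v <= 0 -> v = 0.
Proof.
move=> v0; apply/colP => i; rewrite mxE; apply/eqP.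
rewrite -normr_le0 (le_trans _ v0) // /vnorm1 (bigD1 i) //=.
by rewrite lerDl sumr_ge0.
Qed.

Lemma mxnorm1_col T j : \sum_i `|T i j| <= mxnorm1 T.
Proof. exact: (le_bigmax _ (fun j => \sum_i `|T i j|)). Qed.

Lemma mxnorm1Z a T : 0 <= a -> mxnorm1 (a *: T) <= a * mxnorm1 T.
Proof.
move=> a0; apply: bigmax_le => [|j _].
  by rewrite mulr_ge0 // bigmax_ge_id.
apply: le_trans (ler_wpM2l a0 (mxnorm1_col T j)).
rewrite mulr_sumr ler_sum // => i _.
by rewrite mxE normrM ger0_norm.
Qed.

Lemma vnorm1_mulmx T v : vnorm1 (T *m v) <= mxnorm1 T * vnorm1 v.
Proof.
apply: (@le_trans _ _ (\sum_i \sum_j `|T i j| * `|v j 0|)).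
  rewrite ler_sum // => i _; rewrite mxE (le_trans (ler_norm_sum _ _ _)) //.
  by rewrite ler_sum // => j _; rewrite normrM.
rewrite exchange_big mulr_sumr ler_sum // => j _.
by rewrite -mulr_suml ler_wpM2r // mxnorm1_col.
Qed.

Lemma vnorm1_lpeval q c T v : 0 <= zr R q -> mxnorm1 T <= zr R q ->
  vnorm1 (lpeval c T *m v) <= zr R (lpnorm q c) * vnorm1 v.
Proof.
move=> q0 Tq; elim: c => [|a c IH] /=.
  by rewrite mul0mx zr0 mul0r /vnorm1 big1 // => i _; rewrite mxE normr0.
rewrite mulmxDl mul_scalar_mx zrD mulrDl (le_trans (vnorm1D _ _)) //.
rewrite vnorm1Z lerD //.
  rewrite ler_wpM2r ?vnorm1_ge0 // /zr -intr_norm ler_int; lia.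
rewrite -mulmxA (le_trans (vnorm1_mulmx _ _)) // zrM -mulrA.
by rewrite ler_pM ?vnorm1_ge0 // /mxnorm1 bigmax_ge_id.
Qed.

Lemma unitmx_injective T : (forall v, T *m v = 0 -> v = 0) -> T \in unitmx.
Proof.
move=> T_inj; rewrite -unitmx_tr -row_free_unit -kermx_eq0.
apply/eqP/row_matrixP => i; rewrite row0; apply: trmx_inj; rewrite trmx0.
by apply: T_inj; rewrite -{1}[T]trmxK -trmx_mul -row_mul mulmx_ker row0 trmx0.
Qed.

Lemma theta13_le6 : theta13 R <= 6.
Proof. by rewrite /theta13 !exprS expr0; lra. Qed.

(** A kernel vector of the denominator is also killed by its product with the
    truncated exponential, whose constant term dominates in the 1-norm. *)
Lemma pade13_den_unit T : mxnorm1 T <= theta13 R -> pade13_poly (- T) \in unitmx.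
Proof.
move=> T_le; apply: unitmx_injective => v.
have [b b_neq0 polyE] := pade13_polyE; rewrite (polyE _ T).2 -scalemxAl => /eqP.
rewrite scaler_eq0 (negPf b_neq0) => /eqP pv0.
have {}pv0 : lpeval (lpmul lp_exp_half lp13_opp) T *m v = 0.
  rewrite lpeval_mul lpeval_add lpeval_scale -mulmxA.
  by rewrite -[zr R (-1)]/(-1) scaleN1r pv0 mulmx0.
(* the radius 6 instead of theta13 keeps the certificate integral *)
have T_le6 : mxnorm1 T <= zr R 6.
  by rewrite (le_trans T_le) // (le_trans theta13_le6) // /zr.
have [a [c [eE a0 c_lt_a]]] := lp_exp_half_certificate.
have /eqP : zr R a *: v + T *m (lpeval c T *m v) = 0.
  by rewrite -pv0 eE /= mulmxDl mul_scalar_mx mulmxA.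
rewrite addr_eq0 => /eqP av.
apply/vnorm1_eq0; rewrite leNgt; apply/negP => v0.
have : zr R a * vnorm1 v <= zr R (6 * lpnorm 6 c) * vnorm1 v.
  rewrite -{1}(ger0_norm (_ : 0 <= zr R a)); last by rewrite /zr ler0z; lia.
  rewrite -vnorm1Z av -scaleN1r vnorm1Z normrN1 mul1r.
  rewrite (le_trans (vnorm1_mulmx _ _)) // zrM -mulrA.
  by rewrite ler_pM ?vnorm1_ge0 ?bigmax_ge_id // vnorm1_lpeval // /zr.
rewrite ler_pM2r // leNgt => /negP; apply.
have : 0 < zr R (a - 6 * lpnorm 6 c) by apply: zr_gt0; rewrite subr_gt0.
by rewrite /zr !rmorphB subr_gt0.
Qed.

End Pade13.

(** * Positive semidefinite matrices *)
Section PositiveSemidefinite.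
Variable R : realType.

Lemma psdmxZ n (a : R) (P : 'M[R]_n) : 0 <= a -> psdmx P -> psdmx (a *: P).
Proof.
move=> a0 [P_sym P_ge0]; split; first by rewrite linearZ /= P_sym.
by move=> x; rewrite -scalemxAr -scalemxAl mxE mulr_ge0.
Qed.

Lemma psdmx_congr n m (P : 'M[R]_n) (B : 'M[R]_(n, m)) :
  psdmx P -> psdmx (B^T *m P *m B).
Proof.
move=> [P_sym P_ge0]; split; first by rewrite !trmx_mul trmxK P_sym mulmxA.
by move=> x; have := P_ge0 (B *m x); rewrite trmx_mul !mulmxA.
Qed.

Lemma psdmx1 n : psdmx (1%:M : 'M[R]_n).
Proof.
split=> [|x]; first exact: trmx1.
by rewrite mulmx1 mxE sumr_ge0 // => i _; rewrite mxE -expr2 sqr_ge0.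
Qed.

Lemma psdmx_gram n m (B : 'M[R]_(n, m)) : psdmx (B *m B^T).
Proof. by have := psdmx_congr B^T (psdmx1 m); rewrite trmxK mulmx1. Qed.

Lemma bform_eq0mx n (A : 'M[R]_n) : (forall x y, bform A x y = 0) -> A = 0.
Proof.
move=> A0; apply/matrixP => i j; rewrite [RHS]mxE -(A0 (delta_mx i 0) (delta_mx j 0)).
by rewrite /bform trmx_delta -rowE -colE !mxE.
Qed.

(** The value of the form at [x - t P x] is a nonnegative quadratic function of [t]
    without constant term, so its linear coefficient vanishes; up to a factor
    this is the squared length of [P *m x]. *)
Lemma psdmx_ker n (P : 'M[R]_n) x : psdmx P -> bform P x x = 0 -> P *m x = 0.
Proof.
move=> [P_sym P_ge0] Px0; apply: vnorm1_eq0.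
have sym y z : bform P y z = bform P z y by rewrite -bform_tr P_sym.
set y := P *m x; set b := bform P y x; set c := bform P y y.
have bE : b = \sum_i y i 0 ^+ 2.
  by rewrite /b /bform -mulmxA mxE; apply: eq_bigr => i _; rewrite mxE expr2.
have c0 : 0 <= c := P_ge0 y.
(* the denominator [c + 1] instead of the optimal [c] is nonzero in all cases *)
have := P_ge0 (x - (b / (c + 1)) *: y); rewrite -/(bform _ _ _) => quad_ge0.
have b0 : b = 0.
  have b_ge0 : 0 <= b by rewrite bE sumr_ge0 // => i _; rewrite sqr_ge0.
  move: quad_ge0; rewrite bformDl !bformDr !bformNl !bformNr !bformZl !bformZr.
  rewrite Px0 [bform P x y]sym -/b -/c.
  set t := b / (c + 1).
  have -> : b = t * (c + 1) by rewrite divfK // gt_eqF // ltr_wpDl.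
  move=> quad_ge0; have : 0 <= - (t ^+ 2 * (c + 2)).
    by move: quad_ge0; congr (is_true (0 <= _)); ring.
  rewrite oppr_ge0 pmulr_lle0 ?ltr_wpDl // => t2.
  have /eqP : t ^+ 2 = 0 by apply/le_anti; rewrite t2 sqr_ge0.
  by rewrite sqrf_eq0 => /eqP ->; rewrite mul0r.
rewrite /vnorm1 big1 // => i _.
move: b0; rewrite bE => /psumr_eq0P y0.
have /eqP := y0 (fun i _ => sqr_ge0 (y i 0)) i isT.
by rewrite sqrf_eq0 => /eqP ->; rewrite normr0.
Qed.

End PositiveSemidefinite.

(** * Flows that preserve positive semidefinite Riccati data *)
Section HamiltonianFlows.
Variables (R : realType) (r : nat).
Implicit Types (E : 'M[R]_(r + r)) (x y : 'cV[R]_(r + r)).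

(** For [x = (u, w)] the form [swapmx] at [(x, x)] is [2 * u^T w]; at the columns of
    [(U, W)] it controls the symmetric part of [U^T W]. *)
Definition swapmx : 'M[R]_(r + r) := block_mx 0 1%:M 1%:M 0.

(** The columns of [(U, W)] are isotropic for this form exactly when [U^T W] is
    symmetric. *)
Definition sympmx : 'M[R]_(r + r) := block_mx 0 1%:M (- 1%:M) 0.

Lemma bform_swapE x y : bform swapmx x y =
  ((usubmx x)^T *m dsubmx y + (dsubmx x)^T *m usubmx y) 0 0.
Proof.
rewrite /bform /swapmx -{1}[x]vsubmxK -{1}[y]vsubmxK tr_col_mx.
by rewrite mul_row_block mul_row_col !mulmx0 !mulmx1 add0r addr0 addrC.
Qed.

Lemma bform_sympE x y : bform sympmx x y =
  ((usubmx x)^T *m dsubmx y - (dsubmx x)^T *m usubmx y) 0 0.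
Proof.
rewrite /bform /sympmx -{1}[x]vsubmxK -{1}[y]vsubmxK tr_col_mx.
by rewrite mul_row_block mul_row_col !mulmx0 add0r addr0 mulmxN !mulmx1 mulNmx addrC.
Qed.

Lemma bform_swap_diag x : bform swapmx x x = 2 * ((usubmx x)^T *m dsubmx x) 0 0.
Proof.
rewrite bform_swapE mxE mulr_natl mulr2n; congr (_ + _).
by rewrite !mxE; apply: eq_bigr => i _; rewrite !mxE mulrC.
Qed.

(** The first property keeps [U^T W] symmetric in a step, the second keeps it
    positive semidefinite. *)
Definition riccati_flow E : Prop :=
  (forall x y, bform sympmx (E *m x) (E *m y) = bform sympmx x y) /\
  (forall x, bform swapmx x x <= bform swapmx (E *m x) (E *m x)).

Lemma riccati_flow1 : riccati_flow 1%:M.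
Proof. by split=> x *; rewrite !mul1mx. Qed.

Lemma riccati_flowM E F :
  riccati_flow E -> riccati_flow F -> riccati_flow (E *m F).
Proof.
move=> [EJ EK] [FJ FK]; split=> [x y|x]; rewrite -!mulmxA.
  by rewrite EJ FJ.
exact: le_trans (FK x) (EK _).
Qed.

Lemma riccati_flowX E k : riccati_flow E -> riccati_flow (E ^+ k).
Proof.
move=> Ef; elim: k => [|k IH]; first exact: riccati_flow1.
by rewrite exprS; exact: riccati_flowM.
Qed.

Lemma swapmx_sym : swapmx^T = swapmx.
Proof. by rewrite /swapmx tr_block_mx !trmx0 !trmx1. Qed.

(** The positive semidefinite form [E^T swapmx E - swapmx] vanishes at [z], so [z]
    is in its kernel. Hence [E] preserves the products of [z] with all vectors
    not only for [sympmx] but also for [swapmx], and so for their sum, which is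
    twice the product of an upper with a lower component. *)
Lemma riccati_flow_usub E z : riccati_flow E -> 0 <= bform swapmx z z ->
  usubmx (E *m z) = 0 -> usubmx z = 0.
Proof.
move=> [EJ EK] z_ge0 Uz0; pose K := E^T *m swapmx *m E - swapmx.
have KE x y : bform K x y = bform swapmx (E *m x) (E *m y) - bform swapmx x y.
  by rewrite /K bformBmx bform_congr.
have K_psd : psdmx K.
  split; last by move=> x; rewrite -/(bform K x x) KE subr_ge0.
  by rewrite /K raddfB /= !trmx_mul trmxK swapmx_sym mulmxA.
have Kz0 : K *m z = 0.
  apply: (psdmx_ker K_psd); apply/le_anti; rewrite {2}/bform K_psd.2 andbT.
  by rewrite KE (bform_swap_diag (E *m z)) Uz0 trmx0 mul0mx mxE mulr0 sub0r oppr_le0.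
have upper_lower x y : bform swapmx x y + bform sympmx x y =
    2 * ((usubmx x)^T *m dsubmx y) 0 0.
  by rewrite bform_swapE bform_sympE mxE [X in _ + X]mxE [X in _ + (_ + X)]mxE; ring.
have swap_z x : bform swapmx (E *m z) (E *m x) = bform swapmx z x.
  have K_sym : K^T = K := K_psd.1.
  have : bform K z x = 0 by rewrite -bform_tr K_sym /bform -mulmxA Kz0 mulmx0 mxE.
  by rewrite KE => /eqP; rewrite subr_eq0 => /eqP.
apply/colP => i; rewrite [RHS]mxE.
have := upper_lower z (col_mx 0 (delta_mx i 0)).
rewrite -swap_z -EJ upper_lower Uz0 trmx0 mul0mx mxE mulr0 col_mxKd -colE !mxE.
by move=> /esym/eqP; rewrite mulf_eq0 pnatr_eq0 => /eqP.
Qed.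

(** With [(U, W)] the image of [(1, Y)], the congruence by [invmx U] turns
    [U^T W] into [W U^-1]. *)
Lemma riccati_flow_step E (Y : 'M[R]_r) : riccati_flow E -> psdmx Y ->
  dm_U E Y \in unitmx /\ psdmx (dm_W E Y *m invmx (dm_U E Y)).
Proof.
move=> E_flow [Y_sym Y_ge0]; have [EJ EK] := E_flow.
set U := dm_U E Y; set W := dm_W E Y.
pose z (u : 'cV[R]_r) := col_mx 1%:M Y *m u.
have zE u : z u = col_mx u (Y *m u) by rewrite /z mul_col_mx mul1mx.
have EzE u : E *m z u = col_mx (U *m u) (W *m u).
  by rewrite /z mulmxA -[E *m _]vsubmxK mul_col_mx.
have swap_z u : bform swapmx (z u) (z u) = 2 * (u^T *m Y *m u) 0 0.
  by rewrite bform_swap_diag zE col_mxKu col_mxKd mulmxA.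
have swap_Ez u : bform swapmx (E *m z u) (E *m z u) = 2 * (u^T *m (U^T *m W) *m u) 0 0.
  by rewrite bform_swap_diag EzE col_mxKu col_mxKd trmx_mul !mulmxA.
have UW_ge0 (u : 'cV[R]_r) : 0 <= (u^T *m (U^T *m W) *m u) 0 0.
  have z_ge0 : 0 <= bform swapmx (z u) (z u) by rewrite swap_z mulr_ge0.
  by have := le_trans z_ge0 (EK (z u)); rewrite swap_Ez pmulr_rge0.
have UW_sym : (U^T *m W)^T = U^T *m W.
  rewrite trmx_mul trmxK; apply/esym/eqP; rewrite -subr_eq0.
  apply/eqP/bform_eq0mx => u v.
  have := EJ (z u) (z v); rewrite !bform_sympE !EzE !zE !col_mxKu !col_mxKd.
  rewrite [in RHS]trmx_mul Y_sym [in RHS]mulmxA subrr [RHS]mxE => <-.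
  by rewrite /bform mulmxBr mulmxBl !trmx_mul !mulmxA.
have U_unit : U \in unitmx.
  apply: unitmx_injective => u Uu0.
  rewrite -[u](col_mxKu u (Y *m u)) -zE; apply: riccati_flow_usub E_flow _ _.
    by rewrite swap_z mulr_ge0.
  by rewrite EzE col_mxKu.
split=> //.
have := psdmx_congr (invmx U) (conj UW_sym UW_ge0 : psdmx _).
by rewrite -!mulmxA trmx_inv mulKmx ?unitmx_tr.
Qed.

End HamiltonianFlows.

(** * The Hamiltonian matrix of a Riccati equation *)
Section Hamiltonian.
Variables (R : realType) (r : nat) (H S Q : 'M[R]_r).
Hypotheses (S_psd : psdmx S) (Q_psd : psdmx Q).
Let M := hamiltonian H S Q.
Implicit Types x y : 'cV[R]_(r + r).

Lemma usub_hamiltonian p (x : 'M[R]_(r + r, p)) :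
  usubmx (M *m x) = - H^T *m usubmx x + S *m dsubmx x.
Proof. by rewrite -[in LHS](vsubmxK x) mul_block_col col_mxKu. Qed.

Lemma dsub_hamiltonian p (x : 'M[R]_(r + r, p)) :
  dsubmx (M *m x) = Q *m usubmx x + H *m dsubmx x.
Proof. by rewrite -[in LHS](vsubmxK x) mul_block_col col_mxKd. Qed.

Lemma bform_symp_hamiltonian x y :
  bform (sympmx R r) (M *m x) y = - bform (sympmx R r) x (M *m y).
Proof.
rewrite bformMl -bformMr -bform_oppmx; congr bform.
rewrite /M /hamiltonian /sympmx tr_block_mx !mulmx_block opp_block_mx.
case: S_psd Q_psd => [-> _] [-> _].
rewrite !mul0mx !mulmx0 !mulmxN !mulNmx !mul1mx !mulmx1 !addr0 !add0r.
by rewrite raddfN /= trmxK !opprK.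
Qed.

(** The contributions of [H] and [- H^T] cancel: only the psd blocks are left. *)
Lemma bform_swap_hamiltonian x : bform (swapmx R r) (M *m x) x =
  bform Q (usubmx x) (usubmx x) + bform S (dsubmx x) (dsubmx x).
Proof.
rewrite bform_swapE usub_hamiltonian dsub_hamiltonian.
case: S_psd Q_psd => [S_sym _] [Q_sym _].
rewrite !raddfD /= !trmx_mul raddfN /= trmxK S_sym Q_sym !(mulmxDl, mulNmx, mulmxN).
set u := usubmx x; set w := dsubmx x.
have -> : u^T *m H *m w = w^T *m H^T *m u.
  by apply/matrixP => i j; rewrite !ord1; rewrite -!/(bform _ _ _) bform_tr.
by rewrite [X in _ + X]addrC addrACA addNr add0r addrC mxE.
Qed.

Lemma hamiltonian_accretive x : 0 <= bform (swapmx R r) (M *m x) x.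
Proof.
by rewrite bform_swap_hamiltonian addr_ge0 //; [exact: Q_psd.2|exact: S_psd.2].
Qed.

End Hamiltonian.

(** * The Padé flow *)
Lemma hamiltonianZ (R : realType) r (a : R) (H S Q : 'M[R]_r) :
  a *: hamiltonian H S Q = hamiltonian (a *: H) (a *: S) (a *: Q).
Proof. by rewrite /hamiltonian scale_block_mx scalerN [(a *: H)^T]linearZ. Qed.

Section PadeFlow.
Variables (R : realType) (r : nat) (H S Q : 'M[R]_r).
Hypotheses (S_psd : psdmx S) (Q_psd : psdmx Q).
Let M := hamiltonian H S Q.
Implicit Types x y : 'cV[R]_(r + r).

(** Being Hamiltonian means that [M] is skew-adjoint for the symplectic form, so a
    polynomial in [M] has the polynomial in [- M] as adjoint; parity does the
    rest. *)
Lemma bform_symp_cf bs x y :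
  (bform (sympmx R r) (lpeval (cf_num bs) M *m x) y =
   - bform (sympmx R r) x (lpeval (cf_num bs) M *m y)) *
  (bform (sympmx R r) (lpeval (cf_den bs) M *m x) y =
   bform (sympmx R r) x (lpeval (cf_den bs) M *m y)).
Proof.
have poly c z t : bform (sympmx R r) (lpeval c M *m z) t =
    bform (sympmx R r) z (lpeval c (- M) *m t).
  elim: c z t => [|a c IH] z t /=; first by rewrite !mul0mx bform0l bform0r.
  rewrite !mulmxDl bformDl bformDr !mul_scalar_mx bformZl bformZr; congr (_ + _).
  rewrite -(lpeval_comm c (erefl (- M *m - M))) -!mulmxA.
  by rewrite (@bform_symp_hamiltonian _ _ H _ _ S_psd Q_psd) IH -bformNr -mulmxN -mulNmx.
by rewrite !poly !lpeval_cf_opp mulNmx bformNr.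
Qed.

(** With the partial denominators [2, 6, 10, ...] these are the diagonal Padé
    approximants of the exponential. One step increases the quadratic form by
    four times a sum of growth rates along [M]. *)
Lemma cf_cayley_flow bs :
  let num := lpeval (cf_num bs) M in let den := lpeval (cf_den bs) M in
  all (fun b : Z => 0 < b) bs -> den - num \in unitmx ->
  riccati_flow ((den + num) *m invmx (den - num)).
Proof.
move=> num den bs_gt0 D_unit; set E := _ *m invmx _.
have preim x : exists2 w, x = den *m w - num *m w & E *m x = den *m w + num *m w.
  exists (invmx (den - num) *m x); first by rewrite -mulmxBl mulKVmx.
  by rewrite -mulmxDl mulmxA.
split=> [x y|x].
  have [v -> ->] := preim x; have [w -> ->] := preim y.
  apply: bform_addsub_cross; rewrite !bform_symp_cf opprK !mulmxA.
  by rewrite (lpeval_comm _ (esym (lpeval_comm _ erefl))).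
have [w -> ->] := preim x.
rewrite (bform_addsub_sym (num *m w) (den *m w) (swapmx_sym R r)) lerDl.
rewrite mulr_ge0 // (bform_cf_ge0 (swapmx_sym R r)) //.
exact: hamiltonian_accretive.
Qed.

Lemma pade13_flow : mxnorm1 M <= theta13 R -> riccati_flow (pade13 M).
Proof.
move=> M_small; have [c c_neq0 polyE] := @pade13_polyE R.
have c_unit : c \is a GRing.unit by rewrite unitfE.
have := pade13_den_unit M_small.
rewrite /pade13 (polyE _ M).2 (polyE _ M).1 unitmxZ // => D_unit.
rewrite invmxZ ?unitmxZ // -scalemxAl -scalemxAr scalerA divff // scale1r.
by apply: cf_cayley_flow => //; vm_compute.
Qed.

End PadeFlow.

(** * Derivatives of matrix-valued functions *)
Section MatrixDerivatives.
Variable R : realType.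

Lemma is_derive_mxP m n (F : R -> 'M[R]_(m, n)) t dF :
  is_derive t (1 : R) F dF <->
  forall i j, is_derive t (1 : R) (fun x => F x i j) (dF i j).
Proof.
split=> [[F_der F_val] i j|Fij].
  split; first exact: (derivable_mxP F t 1).1.
  by rewrite -F_val derive_mx // mxE.
have F_der : derivable F t 1 by apply/derivable_mxP => i j; apply: ex_derive.
split=> //; rewrite derive_mx //; apply/matrixP => i j; rewrite mxE.
by apply: derive_val.
Qed.

Lemma is_derive_sum_seq (I : Type) (s : seq I) (P : pred I)
    (F : I -> R -> R) (dF : I -> R) t :
  (forall i, is_derive t (1 : R) (F i) (dF i)) ->
  is_derive t (1 : R) (fun x => \sum_(i <- s | P i) F i x) (\sum_(i <- s | P i) dF i).
Proof.
move=> F_der; elim: s => [|i s IH].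
  rewrite big_nil; under eq_fun do rewrite big_nil; exact: is_derive_cst.
rewrite big_cons; under eq_fun do rewrite big_cons.
by case: ifP => // _; apply: is_deriveD.
Qed.

Lemma derivable_prod_seq (I : Type) (s : seq I) (F : I -> R -> R) t :
  (forall i, derivable (F i) t 1) ->
  derivable (fun x => \prod_(i <- s) F i x) t 1.
Proof.
move=> F_der; elim: s => [|i s IH].
  under eq_fun do rewrite big_nil; exact: derivable_cst.
by under eq_fun do rewrite big_cons; apply: derivableM.
Qed.

Lemma is_derive_mulmx m n p (F : R -> 'M[R]_(m, n)) (G : R -> 'M[R]_(n, p)) t dF dG :
  is_derive t (1 : R) F dF -> is_derive t (1 : R) G dG ->
  is_derive t (1 : R) (fun x => F x *m G x) (dF *m G t + F t *m dG).
Proof.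
move=> /is_derive_mxP F_der /is_derive_mxP G_der; apply/is_derive_mxP => i j.
rewrite !mxE -big_split /=; under eq_fun do rewrite mxE.
apply: is_derive_sum_seq => k; apply: is_derive_eq.
by rewrite addrC; congr (_ + _); rewrite /GRing.scale /= mulrC.
Qed.

Lemma is_derive_mulmxr m n p (F : R -> 'M[R]_(m, n)) (B : 'M[R]_(n, p)) t dF :
  is_derive t (1 : R) F dF -> is_derive t (1 : R) (fun x => F x *m B) (dF *m B).
Proof.
move=> F_der; have := is_derive_mulmx F_der (is_derive_cst B t 1).
by rewrite mulmx0 addr0.
Qed.

Lemma derivable_det n (F : R -> 'M[R]_n) t :
  (forall i j, derivable (fun x => F x i j) t 1) ->
  derivable (fun x => \det (F x)) t 1.
Proof.
move=> F_der.
suff [] : is_derive t (1 : R) (fun x => \det (F x)) (\sum_(s : {perm 'I_n})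
  'D_1 (fun x => (-1) ^+ s * \prod_i F x i (s i)) t) by [].
apply: is_derive_sum_seq => s; apply/derivableP.
by apply: derivableM; [exact: derivable_cst|exact: derivable_prod_seq].
Qed.

(** Differentiability comes from the adjugate formula; the value of the derivative
    is then read off from the constant product [F x *m invmx (F x)]. *)
Lemma is_derive_invmx n (F : R -> 'M[R]_n) t dF :
  is_derive t (1 : R) F dF -> F t \in unitmx ->
  is_derive t (1 : R) (fun x => invmx (F x)) (- (invmx (F t) *m dF *m invmx (F t))).
Proof.
move=> F_der Ft_unit.
have Fij i j : derivable (fun x => F x i j) t 1.
  by apply: (derivable_mxP F t 1).1; apply: ex_derive.
have F_unit : \forall x \near t, F x \in unitmx.
  have det_cont : {for t, continuous (fun x => \det (F x))}.
    by apply/differentiable_continuous/derivable1_diffP; exact: derivable_det.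
  near=> x; rewrite unitmxE unitfE; near: x.
  by apply: cvgr_neq0 det_cont _; rewrite -unitfE -unitmxE.
have G_der : derivable (fun x => invmx (F x)) t 1.
  apply/derivable_mxP => i j.
  have : derivable (fun x => (\det (F x))^-1 * cofactor (F x) j i) t 1.
    apply: derivableM.
      by apply: derivableV; [rewrite -unitfE|exact: derivable_det].
    apply: derivableM; first exact: derivable_cst.
    by apply: derivable_det => k l; under eq_fun do rewrite !mxE; exact: Fij.
  apply: near_eq_derivable.
  near=> x; rewrite /invmx ifT; last by near: x.
  by rewrite !mxE.
have /derivableP G_derP := G_der.
have prod_der := is_derive_mulmx F_der G_derP.
have prod1 : is_derive t (1 : R) (fun x => F x *m invmx (F x)) 0.
  apply: (@near_eq_is_derive _ _ _ (cst (1%:M : 'M[R]_n))).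
  by near=> x; rewrite mulmxV //; near: x.
have /eqP : dF *m invmx (F t) + F t *m 'D_1 (fun x => invmx (F x)) t = 0.
  by rewrite -(@derive_val _ _ _ _ _ _ _ prod1) (@derive_val _ _ _ _ _ _ _ prod_der).
rewrite addrC addr_eq0 => /eqP FdG.
apply: is_derive_eq; rewrite -[LHS](mulKmx Ft_unit) FdG.
by rewrite mulmxN mulmxA.
Unshelve. all: by end_near.
Qed.

End MatrixDerivatives.

(** * The matrix exponential *)
Section MatrixExponential.
Variables (R : realType) (n : nat) (M : 'M[R]_n).

Let coef i j (k : nat) : R := (M ^+ k) i j / k`!%:R.

(** The entries are given as power series, so that termwise differentiation of
    real power series applies. *)
Definition mxexp (t : R) : 'M[R]_n :=
  \matrix_(i, j) limn (pseries (coef i j) t).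

Lemma mxpow_le k i j : `|(M ^+ k) i j| <= (\sum_i \sum_j `|M i j|) ^+ k.
Proof.
set c := \sum_i _; have c0 : 0 <= c by rewrite !sumr_ge0 // => l _; rewrite sumr_ge0.
elim: k i j => [|k IH] i j; first by rewrite !expr0 mxE; case: eqP; rewrite ?normr1 ?normr0.
rewrite !exprS mxE (le_trans (ler_norm_sum _ _ _)) //.
apply: (@le_trans _ _ (\sum_l `|M i l| * c ^+ k)).
  by rewrite ler_sum // => l _; rewrite normrM ler_wpM2l.
rewrite -mulr_suml ler_wpM2r ?exprn_ge0 // /c [leRHS](bigD1 i) //= lerDl sumr_ge0 // => l _.
exact: sumr_ge0.
Qed.

Lemma is_cvg_mxexp i j t : cvgn (pseries (coef i j) t).
Proof.
apply: normed_cvg; set c := \sum_i \sum_j `|M i j|.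
apply: (series_le_cvg (v_ := exp_coeff (c * `|t|))).
- by move=> k /=.
- by move=> k; rewrite exp_coeff_ge0 // mulr_ge0 // sumr_ge0 // => l _; rewrite sumr_ge0.
- move=> k; rewrite /exp_coeff /= normrM normrX normrM normfV normr_nat exprMn mulrAC.
  by rewrite ler_wpM2r // ler_wpM2r ?exprn_ge0 // mxpow_le.
exact: is_cvg_series_exp_coeff.
Qed.

Lemma cvg_mxexp i j t : pseries (coef i j) t @ \oo --> mxexp t i j.
Proof. by rewrite mxE; exact: is_cvg_mxexp. Qed.

Lemma coef_diffs i j :
  pseries_diffs (coef i j) = fun k => \sum_l M i l * coef l j k.
Proof.
apply/funext => k; rewrite /pseries_diffs /coef factS natrM invfM mulrCA !mulrA.
rewrite mulfK ?pnatr_eq0 // exprS mxE mulr_suml.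
by apply: eq_bigr => l _; rewrite mulrA.
Qed.

Lemma cvg_pseries_lincomb (b f : 'I_n -> R) (F : 'I_n -> nat -> R) t :
  (forall l, pseries (F l) t @ \oo --> f l) ->
  pseries (fun k => \sum_l b l * F l k) t @ \oo --> \sum_l b l * f l.
Proof.
move=> Ff.
have -> : pseries (fun k => \sum_l b l * F l k) t =
    (fun N => \sum_l b l * pseries (F l) t N).
  apply/funext => N; rewrite /pseries /series /=.
  under eq_bigr do rewrite mulr_suml.
  rewrite exchange_big; apply: eq_bigr => l _; rewrite mulr_sumr.
  by apply: eq_bigr => k _; rewrite mulrA.
apply: cvg_big => [|l _]; first exact: add_continuous.
exact: cvgMr.
Qed.

Lemma cvg_mxexp_diffs i j t :
  pseries (pseries_diffs (coef i j)) t @ \oo --> (M *m mxexp t) i j.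
Proof.
rewrite coef_diffs mxE; apply: cvg_pseries_lincomb => l; exact: cvg_mxexp.
Qed.

Lemma is_derive_mxexp t : is_derive t (1 : R) mxexp (M *m mxexp t).
Proof.
apply/is_derive_mxP => i j.
have -> : (fun x => mxexp x i j) = (fun x => limn (pseries (coef i j) x)).
  by apply/funext => x; rewrite mxE.
rewrite -(cvg_lim _ (@cvg_mxexp_diffs i j t)) //.
apply: (@pseries_snd_diffs _ _ (`|t| + 1)).
- exact: is_cvg_mxexp.
- by apply/cvg_ex; eexists; exact: cvg_mxexp_diffs.
- have -> : pseries_diffs (pseries_diffs (coef i j)) =
      fun k => \sum_l M i l * pseries_diffs (coef l j) k.
    apply/funext => k; rewrite {1}/pseries_diffs coef_diffs mulr_sumr.
    by apply: eq_bigr => l _; rewrite mulrCA.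
  apply/cvg_ex; eexists; apply: cvg_pseries_lincomb => l; exact: cvg_mxexp_diffs.
by rewrite [ltRHS]ger0_norm ?addr_ge0 // ltrDl.
Qed.

Lemma mxexp0 : mxexp 0 = 1%:M.
Proof.
apply/matrixP => i j; rewrite mxE.
apply: cvg_lim => //; rewrite -(cvg_shiftS (pseries _ _)).
have -> : [sequence pseries (coef i j) 0 k.+1]_k = cst ((1%:M : 'M[R]_n) i j).
  apply/funext => k; rewrite /pseries /series /= big_nat_recl //= big1_seq.
    by rewrite /coef expr0 fact0 invr1 !mulr1 addr0.
  by move=> l _; rewrite expr0n mulr0.
exact: cvg_cst.
Qed.

End MatrixExponential.

(** * Linear differential inequalities and equations on an interval *)
Section IntervalDerivatives.
Variable R : realType.
Implicit Types (a b K : R) (f df : R -> R).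

Lemma ge0_is_derive_le f df a b : a <= b ->
  (forall x, x \in `]a, b[ -> is_derive x (1 : R) f (df x)) ->
  (forall x, x \in `]a, b[ -> 0 <= df x) ->
  {within `[a, b], continuous f} -> f a <= f b.
Proof.
move=> ab f_der df_ge0 f_cont.
case: (ltgtP a b) ab => // [ab _|-> //].
have [c cab E] := MVT ab f_der f_cont.
by rewrite -subr_ge0 E mulr_ge0 ?df_ge0 // subr_ge0 ltW.
Qed.

Lemma is_derive0_eq f a b : a <= b ->
  (forall x, x \in `]a, b[ -> is_derive x (1 : R) f 0) ->
  {within `[a, b], continuous f} -> f a = f b.
Proof.
move=> ab f_der f_cont.
have [c _ /eqP] := MVT_segment ab f_der f_cont.
by rewrite mul0r subr_eq0 => /eqP.
Qed.

Lemma is_derive_within_continuous f df a b :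
  (forall x, x \in `[a, b] -> is_derive x (1 : R) f (df x)) ->
  {within `[a, b], continuous f}.
Proof. by move=> f_der; apply: derivable_within_continuous => x /f_der []. Qed.

(** The function [expR (- K * x) * f x] is nonincreasing. *)
Lemma gronwall_le0 f df K b : 0 <= b ->
  (forall x, x \in `]0, b[ -> is_derive x (1 : R) f (df x)) ->
  (forall x, x \in `]0, b[ -> df x <= K * f x) ->
  {within `[0, b], continuous f} -> f 0 = 0 -> f b <= 0.
Proof.
move=> b0 f_der df_le f_cont f0.
pose g x := - (expR (- K * x) * f x).
have exp_der x : is_derive x (1 : R) (fun y => expR (- K * y)) (- K * expR (- K * x)).
  have lin_der : is_derive x (1 : R) (fun y => - K * y) (- K).
    by apply: is_derive_eq; rewrite /GRing.scale /= ?mulr1 ?mulr0 ?addr0 ?add0r.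
  by rewrite mulrC; exact: is_derive1_comp.
have : g 0 <= g b.
  apply: (@ge0_is_derive_le g (fun x => expR (- K * x) * (K * f x - df x))) => //.
  - move=> x xb; have f_derx := f_der x xb; apply: is_derive_eq.
    by rewrite /GRing.scale /=; ring.
  - by move=> x xb; rewrite mulr_ge0 ?expR_ge0 // subr_ge0 df_le.
  - move=> x; apply: cvgN; apply: cvgM; last exact: f_cont.
    apply: continuous_subspaceT => y; apply: differentiable_continuous.
    by apply/derivable1_diffP; case: (exp_der y).
by rewrite /g f0 mulr0 oppr0 oppr_ge0 pmulr_rle0 // expR_gt0.
Qed.

Lemma young_le (p q s : R) : 2 * (p * (s * q)) <= `|s| * (p ^+ 2 + q ^+ 2).
Proof.
have := sqr_ge0 (p - q); have := sqr_ge0 (p + q); rewrite sqrrB sqrrD => d_ge0 s_ge0.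
rewrite (_ : 2 * _ = s * (p * q *+ 2)); last by ring.
apply: le_trans (ler_norm _) _; rewrite normrM ler_wpM2l // ler_norml.
by apply/andP; split; lra.
Qed.

(** Gronwall applied to the sum of the squares of the entries of [Z], with the
    maximum of the continuous coefficients on the compact interval. *)
Lemma linear_ode_unique m n (A : R -> 'M[R]_m) (Z : R -> 'M[R]_(m, n)) b :
  0 <= b ->
  (forall x, x \in `]0, b[ -> is_derive x (1 : R) Z (A x *m Z x)) ->
  (forall i j, {within `[0, b], continuous (fun x => A x i j)}) ->
  (forall i j, {within `[0, b], continuous (fun x => Z x i j)}) ->
  Z 0 = 0 -> Z b = 0.
Proof.
move=> b0 Z_der A_cont Z_cont Z0.
pose a x := \sum_i \sum_l `|A x i l|.
pose f x := \sum_i \sum_j Z x i j ^+ 2.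
have sum_cont I (s : seq I) (F : I -> R -> R) :
    (forall i, {within `[0, b], continuous (F i)}) ->
    {within `[0, b], continuous (fun x => \sum_(i <- s) F i x)}.
  move=> F_cont x; apply: cvg_big => [|i _]; first exact: add_continuous.
  exact: F_cont.
have a_cont : {within `[0, b], continuous a}.
  apply: (sum_cont) => i; apply: (sum_cont) => l x.
  by apply: continuous_comp; [exact: A_cont|exact: norm_continuous].
have [c cb a_le] := EVT_max b0 a_cont.
suff f_le0 : f b <= 0.
  apply/matrixP => i j; rewrite mxE; apply/eqP.
  rewrite -sqrf_eq0 eq_le sqr_ge0 andbT (le_trans _ f_le0) //.
  rewrite /f (bigD1 i) //= (bigD1 j) //= -addrA lerDl addr_ge0 ?sumr_ge0 // => l _.
    exact: sqr_ge0.
  by rewrite sumr_ge0 // => k _; exact: sqr_ge0.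
pose df x := \sum_i \sum_j 2 * (Z x i j * (A x *m Z x) i j).
apply: (@gronwall_le0 f df (2 * m%:R * a c)) => //.
- move=> x xb; apply: is_derive_sum_seq => i; apply: is_derive_sum_seq => j.
  have Zij := (is_derive_mxP _ _ _).1 (Z_der x xb) i j.
  apply: is_derive_eq; rewrite /GRing.scale /=; ring.
- move=> x xb.
  have term_le i j l : 2 * (Z x i j * (A x i l * Z x l j)) <=
      `|A x i l| * (Z x i j ^+ 2 + Z x l j ^+ 2).
    exact: young_le.
  apply: (@le_trans _ _ (\sum_i \sum_j \sum_l a x * (Z x i j ^+ 2 + Z x l j ^+ 2))).
    rewrite ler_sum // => i _; rewrite ler_sum // => j _.
    rewrite mxE !mulr_sumr ler_sum // => l _; rewrite (le_trans (term_le i j l)) //.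
    rewrite ler_wpM2r ?addr_ge0 ?sqr_ge0 // /a (bigD1 i) //= (bigD1 l) //= -addrA lerDl.
    by rewrite addr_ge0 ?sumr_ge0 // => k _; rewrite sumr_ge0.
  have -> : \sum_i \sum_j \sum_l a x * (Z x i j ^+ 2 + Z x l j ^+ 2) =
      2 * m%:R * a x * f x.
    transitivity (a x * (\sum_i \sum_j (m%:R * Z x i j ^+ 2) +
        \sum_(i < m) \sum_j \sum_l Z x l j ^+ 2)).
      rewrite mulrDr !mulr_sumr -big_split; apply: eq_bigr => i _ /=.
      rewrite !mulr_sumr -big_split; apply: eq_bigr => j _ /=.
      by rewrite -mulr_sumr big_split sumr_const card_ord mulr_natl mulrDr.
    under eq_bigr do rewrite -mulr_sumr.
    rewrite -mulr_sumr -/(f x) sumr_const card_ord exchange_big -/(f x) -mulr_natl.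
    by ring.
  rewrite ler_wpM2r //; first by rewrite sumr_ge0 // => i _; rewrite sumr_ge0 // => j _; rewrite sqr_ge0.
  by rewrite ler_wpM2l ?mulr_ge0 // a_le // (subset_itv_oo_cc xb).
- apply: (sum_cont) => i; apply: (sum_cont) => j.
  have -> : (fun x => Z x i j ^+ 2) = (fun x => Z x i j * Z x i j) by [].
  by move=> x; apply: cvgM; exact: Z_cont.
by rewrite /f big1 // => i _; rewrite big1 // => j _; rewrite Z0 mxE expr0n.
Qed.

End IntervalDerivatives.

(** * The exponential flow *)
Section ExponentialFlow.
Variable R : realType.

Lemma is_derive_trmx m n (F : R -> 'M[R]_(m, n)) t dF :
  is_derive t (1 : R) F dF -> is_derive t (1 : R) (fun x => (F x)^T) dF^T.
Proof.
move=> /is_derive_mxP F_der; apply/is_derive_mxP => i j.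
by rewrite mxE; under eq_fun do rewrite mxE.
Qed.

Lemma is_derive_usubmx m1 m2 n (F : R -> 'M[R]_(m1 + m2, n)) t dF :
  is_derive t (1 : R) F dF -> is_derive t (1 : R) (fun x => usubmx (F x)) (usubmx dF).
Proof.
move=> /is_derive_mxP F_der; apply/is_derive_mxP => i j.
by rewrite mxE; under eq_fun do rewrite mxE.
Qed.

Lemma is_derive_dsubmx m1 m2 n (F : R -> 'M[R]_(m1 + m2, n)) t dF :
  is_derive t (1 : R) F dF -> is_derive t (1 : R) (fun x => dsubmx (F x)) (dsubmx dF).
Proof.
move=> /is_derive_mxP F_der; apply/is_derive_mxP => i j.
by rewrite mxE; under eq_fun do rewrite mxE.
Qed.

Lemma is_derive_bform n (K : 'M[R]_n) (f g : R -> 'cV[R]_n) t df dg :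
  is_derive t (1 : R) f df -> is_derive t (1 : R) g dg ->
  is_derive t (1 : R) (fun x => bform K (f x) (g x))
    (bform K df (g t) + bform K (f t) dg).
Proof.
move=> f_der g_der.
have := is_derive_mulmx (is_derive_mulmxr K (is_derive_trmx f_der)) g_der.
by move=> /is_derive_mxP /(_ 0 0); rewrite mxE.
Qed.

Variables (r : nat) (H S Q : 'M[R]_r).
Hypotheses (S_psd : psdmx S) (Q_psd : psdmx Q).
Let M := hamiltonian H S Q.

Lemma mxexp_flow t : 0 <= t -> riccati_flow (mxexp M t).
Proof.
move=> t0.
have z_der (x : 'cV[R]_(r + r)) s : is_derive s (1 : R) (fun s => mxexp M s *m x) (M *m (mxexp M s *m x)).
  by rewrite mulmxA; apply: is_derive_mulmxr; exact: is_derive_mxexp.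
have swap_der x s : is_derive s (1 : R)
    (fun s => bform (swapmx R r) (mxexp M s *m x) (mxexp M s *m x))
    (2 * bform (swapmx R r) (M *m (mxexp M s *m x)) (mxexp M s *m x)).
  have := is_derive_bform (swapmx R r) (z_der x s) (z_der x s).
  rewrite -[X in _ + X](bform_tr (swapmx R r)) swapmx_sym.
  by rewrite -mulr2n mulr_natl.
have z0 (x : 'cV[R]_(r + r)) : mxexp M 0 *m x = x by rewrite mxexp0 mul1mx.
have swap_le x a b : a <= b ->
    bform (swapmx R r) (mxexp M a *m x) (mxexp M a *m x) <=
    bform (swapmx R r) (mxexp M b *m x) (mxexp M b *m x).
  move=> ab; apply: (ge0_is_derive_le ab (fun s _ => swap_der x s)).
    by move=> s _; rewrite mulr_ge0 // hamiltonian_accretive.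
  exact: is_derive_within_continuous (fun s _ => swap_der x s).
split=> [x y|x].
- have symp_der s : is_derive s (1 : R)
      (fun s => bform (sympmx R r) (mxexp M s *m x) (mxexp M s *m y)) 0.
    have := is_derive_bform (sympmx R r) (z_der x s) (z_der y s).
    by rewrite (bform_symp_hamiltonian H S_psd Q_psd) addNr.
  rewrite -{2}(z0 x) -{2}(z0 y); apply/esym.
  apply: (is_derive0_eq t0 (fun s _ => symp_der s)).
  exact: is_derive_within_continuous (fun s _ => symp_der s).
- by have := swap_le x _ _ t0; rewrite z0.
Qed.

End ExponentialFlow.

(** * The Riccati equation *)
Section Riccati.
Variables (R : realType) (r : nat) (H S Q Y0 : 'M[R]_r).
Hypotheses (S_psd : psdmx S) (Q_psd : psdmx Q) (Y0_psd : psdmx Y0).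
Let M := hamiltonian H S Q.

Definition riccati_U (t : R) := dm_U (mxexp M t) Y0.
Definition riccati_W (t : R) := dm_W (mxexp M t) Y0.
(** Radon's formula: the quotient of the blocks of the linear Hamiltonian system. *)
Definition riccati_Y (t : R) := riccati_W t *m invmx (riccati_U t).

Lemma is_derive_riccati_U t :
  is_derive t (1 : R) riccati_U (- H^T *m riccati_U t + S *m riccati_W t).
Proof.
rewrite /riccati_U /riccati_W /dm_U /dm_W -(usub_hamiltonian H S Q).
apply: is_derive_usubmx; rewrite mulmxA.
by apply: is_derive_mulmxr; exact: is_derive_mxexp.
Qed.

Lemma is_derive_riccati_W t :
  is_derive t (1 : R) riccati_W (Q *m riccati_U t + H *m riccati_W t).
Proof.
rewrite /riccati_U /riccati_W /dm_U /dm_W -(dsub_hamiltonian H S Q).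
apply: is_derive_dsubmx; rewrite mulmxA.
by apply: is_derive_mulmxr; exact: is_derive_mxexp.
Qed.

Lemma riccati_U_unit t : 0 <= t -> riccati_U t \in unitmx.
Proof. by move=> t0; have [] := riccati_flow_step (mxexp_flow H S_psd Q_psd t0) Y0_psd. Qed.

Lemma riccati_Y_psd t : 0 <= t -> psdmx (riccati_Y t).
Proof. by move=> t0; have [] := riccati_flow_step (mxexp_flow H S_psd Q_psd t0) Y0_psd. Qed.

Lemma riccati_U0 : riccati_U 0 = 1%:M.
Proof. by rewrite /riccati_U /dm_U mxexp0 mul1mx col_mxKu. Qed.

Lemma riccati_W0 : riccati_W 0 = Y0.
Proof. by rewrite /riccati_W /dm_W mxexp0 mul1mx col_mxKd. Qed.

Lemma riccati_Y0 : riccati_Y 0 = Y0.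
Proof. by rewrite /riccati_Y riccati_U0 riccati_W0 invmx1 mulmx1. Qed.

Lemma is_derive_riccati_Y (t : R) : 0 <= t ->
  is_derive t (1 : R) riccati_Y (riccati_rhs H S Q (riccati_Y t)).
Proof.
move=> t0; have U_unit := riccati_U_unit t0.
have := is_derive_mulmx (is_derive_riccati_W t)
  (is_derive_invmx (is_derive_riccati_U t) U_unit).
congr is_derive; rewrite /riccati_rhs /riccati_Y.
set U := riccati_U t in U_unit *; set W := riccati_W t.
have -> : (Q *m U + H *m W) *m invmx U = Q + H *m (W *m invmx U).
  by rewrite mulmxDl mulmxK // mulmxA.
have -> : invmx U *m (- H^T *m U + S *m W) *m invmx U =
    invmx U *m (S *m (W *m invmx U) - H^T).
  by rewrite -mulmxA mulmxDl mulmxK // mulmxA addrC.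
rewrite mulmxN [W *m (_ *m _)]mulmxA; set Y := W *m invmx U.
rewrite mulmxBr opprB mulmxA addrA; congr (_ - _); last by rewrite mulmxA.
by rewrite [Q + _]addrC addrAC.
Qed.

(** For any other solution [Y'] the defect [Z = Y' U - W] satisfies the linear
    equation [Z' = (H - Y' S) Z] with [Z 0 = 0]. *)
Lemma riccati_unique (T : \bar R) Y' : riccati_solution H S Q Y0 T Y' ->
  forall u : R, 0 <= u -> (u%:E < T)%E -> Y' u = riccati_Y u.
Proof.
move=> [Y'0 Y'_cvg Y'_der] u; rewrite le_eqVlt => /orP[/eqP <- _|u0 uT].
  by rewrite Y'0 riccati_Y0.
pose Z x := Y' x *m riccati_U x - riccati_W x.
pose A x := H - Y' x *m S.
suff Zu : Z u = 0.
  move/eqP: Zu; rewrite subr_eq0 => /eqP Y'U.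
  by rewrite /riccati_Y -Y'U mulmxK // riccati_U_unit // ltW.
have Y'_der_itv x : x \in `]0, u] ->
    is_derive x (1 : R) Y' (riccati_rhs H S Q (Y' x)).
  rewrite in_itv /= => /andP[x0 xu]; apply: Y'_der => //.
  by rewrite (le_lt_trans _ uT) // lee_fin.
have Y'_cont i j : {within `[0, u], continuous (fun x => Y' x i j)}.
  have Y'_cont_itv x : x \in `]0, u] -> {for x, continuous (fun x => Y' x i j)}.
    move=> xu; apply/differentiable_continuous/derivable1_diffP.
    have Y'_derx := (is_derive_mxP _ _ _).1 (Y'_der_itv x xu) i j.
    exact: ex_derive.
  apply/continuous_within_itvP => //; split.
  - by move=> x xu; apply: Y'_cont_itv; apply: subset_itv_oo_oc xu.
  - rewrite Y'0; exact: (cvg_comp Y' (fun N : 'M[R]_r => N i j) Y'_cvg (@coord_continuous _ _ _ i j Y0)).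
  - by apply: cvg_at_left_filter; apply: Y'_cont_itv; rewrite in_itv /= u0 lexx.
have U_cont i j : {within `[0, u], continuous (fun x => riccati_U x i j)}.
  have U_der x := (is_derive_mxP _ _ _).1 (is_derive_riccati_U x) i j.
  exact: (is_derive_within_continuous (fun x _ => U_der x)).
have W_cont i j : {within `[0, u], continuous (fun x => riccati_W x i j)}.
  have W_der x := (is_derive_mxP _ _ _).1 (is_derive_riccati_W x) i j.
  exact: (is_derive_within_continuous (fun x _ => W_der x)).
have mul_cont (F G : R -> 'M[R]_r) :
    (forall i j, {within `[0, u], continuous (fun x => F x i j)}) ->
    (forall i j, {within `[0, u], continuous (fun x => G x i j)}) ->
    forall i j, {within `[0, u], continuous (fun x => (F x *m G x) i j)}.
  move=> F_cont G_cont i j.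
  have -> : (fun x => (F x *m G x) i j) = (fun x => \sum_k F x i k * G x k j).
    by apply/funext => x; rewrite mxE.
  move=> x; apply: cvg_big => [|k _]; first exact: add_continuous.
  by apply: cvgM; [exact: F_cont|exact: G_cont].
refine (@linear_ode_unique R r r A Z u (ltW u0) _ _ _ _).
- move=> x xu; have xu' : x \in `]0, u] := subset_itv_oo_oc xu.
  have Y'U_der := is_derive_mulmx (Y'_der_itv x xu') (is_derive_riccati_U x).
  have W_der := is_derive_riccati_W x.
  rewrite /Z; apply: is_derive_eq; rewrite /riccati_rhs /A.
  rewrite !mulmxBl !mulmxBr !mulmxDl !mulmxDr !mulNmx !mulmxN !mulmxA.
  by apply/matrixP => i j; do !rewrite [in LHS]mxE; do !rewrite [in RHS]mxE; ring.
- move=> i j.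
  have -> : (fun x => A x i j) = (fun x => H i j - (Y' x *m S) i j).
    by apply/funext => x; rewrite /A 2!mxE.
  move=> x; apply: cvgB; first exact: cvg_cst.
  by apply: (mul_cont _ _ Y'_cont) => k l y; exact: cvg_cst.
- move=> i j.
  have -> : (fun x => Z x i j) =
      (fun x => (Y' x *m riccati_U x) i j - riccati_W x i j).
    by apply/funext => x; rewrite /Z mxE [X in _ + X]mxE.
  by move=> x; apply: cvgB; [exact: (mul_cont _ _ Y'_cont U_cont)|exact: W_cont].
by rewrite /Z Y'0 riccati_U0 riccati_W0 mulmx1 subrr.
Qed.

End Riccati.

(** * Positivity of the Krylov approximation *)
Theorem theorem3p2 (R : realType) (n p q k r : nat)
    (A S : 'M[R]_n) (Z : 'M[R]_(n, p)) (C : 'M[R]_(n, q)) (V : 'M[R]_(n, r))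
    (S_psd : psdmx S)
    (k_gt0 : (0 < k)%N)
    (V_orthonormal : V^T *m V = 1%:M)
    (V_span : colspan V = krylov k A (row_mx Z C)) :
  let Hk := V^T *m A *m V in
  let Sk := V^T *m S *m V in
  let Ck := V^T *m C in
  let Zk := V^T *m Z in
  let Qk := Ck *m Ck^T in
  let Y0 := Zk *m Zk^T in
  (exists Y : R -> 'M[R]_r,
    [/\ riccati_solution Hk Sk Qk Y0 +oo%E Y,
        (forall (T : \bar R) (Y' : R -> 'M[R]_r),
           riccati_solution Hk Sk Qk Y0 T Y' ->
           forall u : R, 0 <= u -> (u%:E < T)%E -> Y' u = Y u) &
        forall t : R, 0 < t -> psdmx (V *m Y t *m V^T)])
  /\
  (forall (t : R) (m s : nat), 0 < t -> (0 < m)%N ->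
    let M := (t / m%:R) *: hamiltonian Hk Sk Qk in
    admissible s M ->
    let E := pade13_exp s M in
    let Yj := dm_iter E Y0 in
    [/\ pade13_poly (- (2 ^- s *: M)) \in unitmx,
        (forall j : nat, (j < m)%N -> dm_U E (Yj j) \in unitmx),
        (forall j : nat, (j <= m)%N -> psdmx (Yj j)) &
        psdmx (V *m Yj m *m V^T)]).
Proof.
move=> Hk Sk Ck Zk Qk Y0.
have Sk_psd : psdmx Sk by exact: psdmx_congr.
have Qk_psd : psdmx Qk by exact: psdmx_gram.
have Y0_psd : psdmx Y0 by exact: psdmx_gram.
have lift_psd Y : psdmx Y -> psdmx (V *m Y *m V^T).
  by move=> Y_psd; have := psdmx_congr V^T Y_psd; rewrite trmxK.
split.
  have Y_der (t : R) (t0 : 0 <= t) := is_derive_riccati_Y Hk Sk_psd Qk_psd Y0_psd t0.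
  have Y_0 := riccati_Y0 Hk Sk Qk Y0.
  exists (riccati_Y Hk Sk Qk Y0); split.
  - split=> [//||u u0 _]; last exact: Y_der (ltW u0).
    rewrite -[X in _ --> X]Y_0; apply: cvg_at_right_filter.
    apply/differentiable_continuous/derivable1_diffP.
    by case: (Y_der 0 (lexx 0)).
  - by move=> T Y' Y'_sol; exact: riccati_unique.
  - by move=> t t0; apply/lift_psd/riccati_Y_psd => //; exact: ltW.
move=> t m s t0 m0 M s_adm E Yj.
have pow_gt0 : 0 < 2 ^- s :> R by rewrite invr_gt0 exprn_gt0.
have M_small : mxnorm1 (2 ^- s *: M) <= theta13 R.
  by rewrite (le_trans (mxnorm1Z _ (ltW pow_gt0))).
have E_flow : riccati_flow E.
  apply: riccati_flowX; move: M_small; rewrite /M scalerA hamiltonianZ => M_small.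
  have step_ge0 : 0 <= 2 ^- s * (t / m%:R) by rewrite mulr_ge0 ?divr_ge0 // ltW.
  by apply: pade13_flow => //; exact: psdmxZ.
have Yj_psd j : psdmx (Yj j).
  elim: j => [|j IH] //=; exact: (riccati_flow_step E_flow IH).2.
split=> //; first exact: pade13_den_unit.
  by move=> j _; exact: (riccati_flow_step E_flow (Yj_psd j)).1.
exact: lift_psd.
Qed.
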